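(* Let $\{x_k\}$ be generated by Algorithm TRishBB applied to $f$. Suppose that: (i) $f:\mathbb{R}^n\to\mathbb{R}$ is continuously differentiable, bounded below by $f_*$, and there is $L>0$ with $f(x)\le f(y)+\nabla f(y)^T(x-y)+\frac{L}{2}\|x-y\|^2$ for all $x,y\in\mathbb{R}^n$; (ii) there are positive constants $\omega,M_1,M_2$ such that for all $k$, $\nabla f(x_k)^T\mathbb{E}_k[g_k]\ge\omega\|\nabla f(x_k)\|^2$ and $\mathbb{E}_k[\|g_k\|^2]\le M_1+M_2\|\nabla f(x_k)\|^2$; (iii) $0<\mu_{min}\le\gamma_2\alpha$. Define $h_1=\frac12\sqrt{M_1}$, $h_2=h_1+\sqrt{M_2}$, $\rho=\frac{\mu_{min}}{\alpha\gamma_2}\in(0,1]$, $$\theta_1=\tfrac12\omega\gamma_1-h_2(\gamma_1-\rho\gamma_2),\qquad \theta_2=h_1(\gamma_1\alpha-\mu_{min})+\tfrac12\gamma_1^2LM_1\alpha^2 .$$ Suppose further that, in case $h_2-\frac12\omega>0$, it holds $$\frac{\gamma_1}{\gamma_2}<\frac{\rho h_2}{h_2-\frac12\omega},$$ and that $$\alpha\le\frac{\omega}{\gamma_1LM_2}.$$ Then the iterates satisfy $$\sum_{k=0}^K\mathbb{E}\left[\frac1K\|\nabla f(x_k)\|^2\right]\ \xrightarrow{K\to\infty}\ \frac{\theta_2}{\alpha\,\theta_1}.$$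
   Context: Objective: $f(x)=\frac1N\sum_{i=1}^N f_i(x)$ with each $f_i:\mathbb{R}^n\to\mathbb{R}$ continuously differentiable. $\|\cdot\|$ is the Euclidean norm. Algorithm TRishBB: choose an initial $x_0\in\mathbb{R}^n$, constants $\alpha>0$, $0<\gamma_2\le\gamma_1<\infty$, $\mu_{min}>0$, and $\mu_0>0$. At each iteration $k=0,1,2,\dots$: compute a stochastic gradient $g_k\in\mathbb{R}^n$ (a random vector approximating $\nabla f(x_k)$); set $$\Delta_k=\begin{cases}\alpha\gamma_1\|g_k\| & \text{if }\|g_k\|\in[0,\frac1{\gamma_1}),\\ \alpha & \text{if }\|g_k\|\in[\frac1{\gamma_1},\frac1{\gamma_2}],\\ \alpha\gamma_2\|g_k\| & \text{if }\|g_k\|\in(\frac1{\gamma_2},\infty);\end{cases}$$ let $p_k$ be the solution of $\min_{p\in\mathbb{R}^n} m_k(p)=g_k^Tp+\frac{1}{2\mu_k}\|p\|^2$ subject to $\|p\|\le\Delta_k$ (so $p_k=-\mu_kg_k$ if $\|\mu_kg_k\|<\Delta_k$, and $p_k=-\frac{\Delta_k}{\|g_k\|}g_k$ otherwise, with $p_k=0$ if $g_k=0$); set $x_{k+1}=x_k+p_k$; form a parameter $\mu_{k+1}\ge\mu_{min}$. It is assumed that $\mu_k\ge\mu_{min}$ for all $k\ge0$. $\mathbb{E}_k[\cdot]$ is the conditional expectation given that the algorithm has reached $x_k$ at iteration $k$; $\mathbb{E}[\cdot]$ is the expected value taken with the joint distribution of all random variables.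
   Formalization: The claimed convergence to θ2/(αθ1) is false (f=0, g_k=0, all constants 1: the sums are 0 but the claimed limit is 1); it is replaced by the asymptotic upper bound limsup_{K→∞} Σ_{k=0}^K E[(1/K)‖∇f(x_k)‖²] ≤ θ2/(αθ1). *)

(* Defs.v *)
From HB Require Import structures.
From mathcomp Require Import all_boot all_order all_algebra.
From mathcomp Require Import all_classical all_reals all_analysis.

Set Implicit Arguments.
Unset Strict Implicit.
Unset Printing Implicit Defensive.

Import Order.TTheory GRing.Theory Num.Theory.
Import numFieldNormedType.Exports.

Local Open Scope classical_set_scope.
Local Open Scope ring_scope.

Definition dotp (R : realType) (n : nat) (u v : 'rV[R]_n) : R :=
  \sum_(i < n) u 0 i * v 0 i.

(* The library norm on 'rV[R]_n is the sup norm; the Euclidean one is needed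
   here. *)
Definition enorm (R : realType) (n : nat) (u : 'rV[R]_n) : R :=
  Num.sqrt (dotp u u).

Definition grad (R : realType) (n : nat) (f : 'rV[R]_n -> R) (x : 'rV[R]_n) :
    'rV[R]_n :=
  \row_(i < n) 'D_(delta_mx 0 i) f x.

Definition cont_diff (R : realType) (n : nat) (f : 'rV[R]_n -> R) : Prop :=
  (forall x, differentiable f x) /\ continuous (grad f).

Definition average (R : realType) (n N : nat) (f_ : 'I_N -> 'rV[R]_n -> R)
    (x : 'rV[R]_n) : R :=
  N%:R^-1 * \sum_(i < N) f_ i x.

Definition tr_radius (R : realType) (alpha gamma1 gamma2 t : R) : R :=
  if t < gamma1^-1 then alpha * gamma1 * t
  else if t <= gamma2^-1 then alpha
  else alpha * gamma2 * t.

Definition model (R : realType) (n : nat) (g : 'rV[R]_n) (mu : R)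
    (p : 'rV[R]_n) : R :=
  dotp g p + (2 * mu)^-1 * enorm p ^+ 2.

Definition tr_solution (R : realType) (n : nat) (g : 'rV[R]_n) (mu Delta : R)
    (p : 'rV[R]_n) : Prop :=
  enorm p <= Delta /\
  forall q : 'rV[R]_n, enorm q <= Delta -> model g mu p <= model g mu q.

Definition random_vector d (T : measurableType d) (R : realType) (n : nat)
    (X : T -> 'rV[R]_n) : Prop :=
  forall i : 'I_n, measurable_fun [set: T] (fun w => X w 0 i).

(* The stochastic gradients g_k and the parameters mu_k (k >= 1) are arbitrary
   random variables: neither the sampling scheme nor the rule producing mu_k is
   prescribed, and they may depend on each other and on the past. *)
Record TRishBB d (T : measurableType d) (R : realType) (n : nat)
    (alpha gamma1 gamma2 mu_min mu0 : R) (x0 : 'rV[R]_n)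
    (x g p : nat -> T -> 'rV[R]_n) (mu : nat -> T -> R) : Prop := {
  TRishBB_alpha : 0 < alpha;
  TRishBB_gamma2 : 0 < gamma2;
  TRishBB_gamma : gamma2 <= gamma1;
  TRishBB_mu_min : 0 < mu_min;
  TRishBB_mu0 : 0 < mu0;
  TRishBB_g_random : forall k, random_vector (g k);
  TRishBB_mu_random : forall k, measurable_fun [set: T] (mu k);
  TRishBB_x_init : forall w, x 0%N w = x0;
  TRishBB_mu_init : forall w, mu 0%N w = mu0;
  TRishBB_mu_ge : forall k w, mu_min <= mu k w;
  TRishBB_p : forall k w,
    tr_solution (g k w) (mu k w)
      (tr_radius alpha gamma1 gamma2 (enorm (g k w))) (p k w);
  TRishBB_x_next : forall k w, x k.+1 w = x k w + p k w
}.

Definition sigma_vector (T : Type) (R : realType) (n : nat)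
    (X : T -> 'rV[R]_n) : set (set T) :=
  g_sigma_preimage (fun (i : 'I_n) (w : T) => X w 0 i).

(* Y is a version of E[X | G] for a nonnegative, not necessarily integrable, X.
   In all versions below, G is meant to be a sub-sigma-algebra. *)
Definition is_condexp_ge0 d (T : measurableType d) (R : realType)
    (P : probability T R) (G : set (set T)) (X Y : T -> R) : Prop :=
  [/\ measurable_fun [set: T] X,
      forall w, 0 <= X w,
      forall w, 0 <= Y w,
      preimage_set_system [set: T] Y measurable `<=` G &
      forall A, G A ->
        (\int[P]_(w in A) (Y w)%:E = \int[P]_(w in A) (X w)%:E)%E].

(* Y is a version of E[X | G] := E[X^+ | G] - E[X^- | G], both terms being
   finite.  For an integrable X this is the usual conditional expectation;
   integrability of X is not presupposed. *)
Definition is_condexp d (T : measurableType d) (R : realType)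
    (P : probability T R) (G : set (set T)) (X Y : T -> R) : Prop :=
  exists Yp Yn : T -> R,
    [/\ is_condexp_ge0 P G X^\+ Yp,
        is_condexp_ge0 P G X^\- Yn &
        forall w, Y w = Yp w - Yn w].

Definition is_condexp_vector d (T : measurableType d) (R : realType)
    (P : probability T R) (G : set (set T)) (n : nat)
    (X Y : T -> 'rV[R]_n) : Prop :=
  forall i : 'I_n, is_condexp P G (fun w => X w 0 i) (fun w => Y w 0 i).

(* Main.v *)
(* Since mu_min <= gamma2 * alpha, the trust-region step is p_k = - s g_k with
   mu_min <= s <= alpha * gamma1. Smoothness of f and Young's inequality with
   weight c = sqrt M1 + sqrt M2 on the cross term
   (alpha * gamma1 - s) <G_k, g_k>, where G_k = grad f (x_k), bound f (x_{k+1})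
   pointwise by f (x_k) - alpha gamma1 <G_k, g_k> + a |G_k|^2 + b |g_k|^2.
   In expectation, pulling G_k out of E_k gives E<G_k, g_k> >= omega E|G_k|^2,
   and the bound becomes
     alpha theta1 E|G_k|^2 <= E f(x_k) - E f(x_{k+1}) + theta2,
   which telescopes. All these expectations are finite by induction on k:
   |G_k|^2 <= 2 L (f (x_k) - fstar) turns integrability of f (x_k) into square
   integrability of G_k, hence of g_k, and the descent inequality then makes
   f (x_{k+1}) integrable. *)
Require Import Defs.
From HB Require Import structures.
From mathcomp Require Import all_boot all_order all_algebra.
From mathcomp Require Import all_classical all_reals all_analysis.
From mathcomp Require Import measurable_realfun.
From mathcomp Require Import ring lra.

Set Implicit Arguments.
Unset Strict Implicit.
Unset Printing Implicit Defensive.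

Import Order.TTheory GRing.Theory Num.Theory.
Import numFieldNormedType.Exports.

Local Open Scope classical_set_scope.
Local Open Scope ring_scope.

(** * The Euclidean structure and the trust-region step *)

Section euclidean.
Context (R : realType) (n : nat).
Implicit Types (a : R) (u v w : 'rV[R]_n).

Lemma dotpC u v : dotp u v = dotp v u.
Proof. by apply: eq_bigr => i _; rewrite mulrC. Qed.

Lemma dotpDr u v w : dotp u (v + w) = dotp u v + dotp u w.
Proof. by rewrite -big_split; apply: eq_bigr => i _; rewrite mxE mulrDr. Qed.

Lemma dotpZr a u v : dotp u (a *: v) = a * dotp u v.
Proof. by rewrite mulr_sumr; apply: eq_bigr => i _; rewrite mxE mulrCA. Qed.

Lemma dotpDl u v w : dotp (u + v) w = dotp u w + dotp v w.
Proof. by rewrite dotpC dotpDr !(dotpC w). Qed.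

Lemma dotpZl a u v : dotp (a *: u) v = a * dotp u v.
Proof. by rewrite dotpC dotpZr dotpC. Qed.

Lemma dotp0r u : dotp u 0 = 0.
Proof. by rewrite -(scale0r u) dotpZr mul0r. Qed.

Lemma dotpp_ge0 u : 0 <= dotp u u.
Proof. by apply: sumr_ge0 => i _; rewrite -expr2 sqr_ge0. Qed.

Lemma dotpp_eq0 u : dotp u u = 0 -> u = 0.
Proof.
move=> u0; apply/rowP => i; apply/eqP; rewrite mxE -sqrf_eq0 expr2.
move/eqP: u0; rewrite psumr_eq0 => [|j _]; last by rewrite -expr2 sqr_ge0.
by move=> /allP/(_ i); rewrite mem_index_enum => /(_ isT).
Qed.

Lemma enorm_ge0 u : 0 <= enorm u.
Proof. exact: sqrtr_ge0. Qed.

Lemma enorm_sqr u : enorm u ^+ 2 = dotp u u.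
Proof. by rewrite sqr_sqrtr// dotpp_ge0. Qed.

Lemma enorm0 : enorm (0 : 'rV[R]_n) = 0.
Proof. by rewrite /enorm dotp0r sqrtr0. Qed.

Lemma enorm_eq0 u : (enorm u == 0) = (u == 0).
Proof.
apply/eqP/eqP => [u0|->]; last exact: enorm0.
by apply: dotpp_eq0; rewrite -enorm_sqr u0 expr0n.
Qed.

Lemma enormZ_sqr a u : enorm (a *: u) ^+ 2 = a ^+ 2 * enorm u ^+ 2.
Proof. by rewrite !enorm_sqr dotpZl dotpZr; ring. Qed.

(** Expanding the square of [enorm v *: u + (a * enorm u) *: v] with [a] equal to [1] and to [-1]
    bounds [dotp u v] from both sides. *)
Lemma cauchy_schwarz u v : `|dotp u v| <= enorm u * enorm v.
Proof.
have [->|u0] := eqVneq u 0; first by rewrite dotpC dotp0r enorm0 mul0r normr0.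
have [->|v0] := eqVneq v 0; first by rewrite dotp0r enorm0 mulr0 normr0.
have pu : 0 < enorm u by rewrite lt_def enorm_eq0 u0 enorm_ge0.
have pv : 0 < enorm v by rewrite lt_def enorm_eq0 v0 enorm_ge0.
have signed a : a ^+ 2 = 1 -> - (a * dotp u v) <= enorm u * enorm v.
  move=> a2; have := dotpp_ge0 (enorm v *: u + (a * enorm u) *: v).
  rewrite !(dotpDl, dotpDr, dotpZl, dotpZr) -!enorm_sqr (dotpC v u).
  rewrite (_ : _ + _ = 2 * (enorm u * enorm v) *
      (enorm u * enorm v + a * dotp u v)
    + (a ^+ 2 - 1) * (enorm u * enorm v) ^+ 2); last by ring.
  by rewrite a2 subrr mul0r addr0 pmulr_rge0 ?mulr_gt0// -lerBlDr sub0r.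
have := signed 1 (expr1n _ _); have := signed (-1) (sqrr_sign _ 1).
rewrite ler_norml; lra.
Qed.

(** Expand [dotp (a *: u - v) (a *: u - v) >= 0] and divide by [2 * a]. *)
Lemma young a u v : 0 < a ->
  dotp u v <= 2^-1 * (a * enorm u ^+ 2 + enorm v ^+ 2 / a).
Proof.
move=> a0; have := dotpp_ge0 (a *: u - v).
rewrite -scaleN1r !(dotpDl, dotpDr, dotpZl, dotpZr) -!enorm_sqr (dotpC v u).
move=> h; rewrite -(ler_pM2l a0).
rewrite (_ : a * (_ * _) = 2^-1 * (a ^+ 2 * enorm u ^+ 2 + enorm v ^+ 2)).
  by lra.
by field; lra.
Qed.

End euclidean.

(* At [g = 0] the quotient is [0] by convention, which still gives the correct
   step [- tr_step Delta mu g *: g = 0] but not the bounds on its length. *)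
Definition tr_step (R : realType) (n : nat) (Delta mu : R) (g : 'rV[R]_n) : R :=
  Num.min mu (Delta / enorm g).

Section trust_region_step.
Context (R : realType) (n : nat).
Implicit Types (g p : 'rV[R]_n).

(** With [s] the claimed length and [e := p + s *: g], comparing [p] with the feasible point
    [- s *: g] leaves [(2 * mu)^-1 * dotp e e <= - ((1 - s / mu) * dotp g e)]. The right-hand side
    is nonpositive, so [e = 0]. *)
Lemma tr_solutionE g mu Delta p : 0 < mu -> (g = 0 -> Delta = 0) ->
  tr_solution g mu Delta p -> p = - tr_step Delta mu g *: g.
Proof.
move=> mu0 Delta0 [pD pmin].
have [g0|g0] := eqVneq g 0.
  apply/eqP; rewrite g0 scaler0 -enorm_eq0 eq_le enorm_ge0 andbT.
  by rewrite (le_trans pD)// Delta0.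
have gp : 0 < enorm g by rewrite lt_def enorm_eq0 g0 enorm_ge0.
set s := tr_step _ _ _.
have s0 : 0 <= s.
  rewrite le_min (ltW mu0) divr_ge0 ?enorm_ge0//.
  exact: le_trans (enorm_ge0 p) pD.
have sD : s * enorm g <= Delta by rewrite -ler_pdivlMr// ge_min lexx orbT.
have qD : enorm (- s *: g) <= Delta.
  rewrite (le_trans _ sD)// -ler_sqr ?nnegrE ?enorm_ge0 ?mulr_ge0//.
    by rewrite enormZ_sqr sqrrN exprMn.
  by rewrite enorm_ge0.
have := pmin _ qD.
pose e := p + s *: g.
have pE : p = e + - s *: g by rewrite /e scaleNr addrK.
rewrite {1}pE; clearbody e.
rewrite /model enormZ_sqr !enorm_sqr !(dotpDl, dotpDr, dotpZl, dotpZr).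
rewrite (dotpC e g) => h.
(* Either [s = mu] and the first factor vanishes, or [- s *: g] lies on the boundary of the region,
   and Cauchy-Schwarz with [enorm p <= Delta] makes [dotp g e] nonnegative. *)
have sg : 0 <= (1 - s / mu) * dotp g e.
  have [Ds|muD] := leP (Delta / enorm g) mu; last first.
    by rewrite /s /tr_step (min_idPl (ltW muD)) divff ?gt_eqF// subrr mul0r.
  have sE : s = Delta / enorm g by exact/min_idPr.
  rewrite mulr_ge0 ?subr_ge0 ?ler_pdivrMr ?mul1r ?sE//.
  have : dotp g p = dotp g e - s * enorm g ^+ 2.
    by rewrite pE dotpDr dotpZr enorm_sqr mulNr.
  have -> : s * enorm g ^+ 2 = enorm g * Delta by rewrite sE; field; lra.
  move=> gpE; have := cauchy_schwarz g p; rewrite gpE ler_norml.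
  move=> /andP[gp_ge _].
  have := ler_wpM2l (enorm_ge0 g) pD; lra.
have : (2 * mu)^-1 * dotp e e <= - ((1 - s / mu) * dotp g e).
  have -> : (1 - s / mu) * dotp g e =
    dotp g e - 2 * (2 * mu)^-1 * s * dotp g e by field; lra.
  move: h; rewrite sqrrN; lra.
move=> {}h; have {h} : (2 * mu)^-1 * dotp e e <= 0 by lra.
rewrite pmulr_rle0 ?invr_gt0 ?mulr_gt0// => ee.
have e0 : e = 0 by apply: dotpp_eq0; apply/eqP; rewrite eq_le ee dotpp_ge0.
by rewrite pE e0 add0r.
Qed.

Context (alpha gamma1 gamma2 : R).
Hypotheses (alpha_gt0 : 0 < alpha) (gamma2_gt0 : 0 < gamma2)
  (gamma_le : gamma2 <= gamma1).

(** One of the two bounds is attained on each outer branch; on the middle one the ratio is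
    [alpha / t] with [t] between [gamma1^-1] and [gamma2^-1]. *)
Lemma tr_radius_bounds t : 0 < t ->
  alpha * gamma2 <= tr_radius alpha gamma1 gamma2 t / t <= alpha * gamma1.
Proof.
move=> t0; have gamma1_gt0 : 0 < gamma1 by exact: lt_le_trans gamma_le.
rewrite ler_pdivlMr// ler_pdivrMr// /tr_radius -!mulrA.
have [t1|t1] := ltP t gamma1^-1.
  by rewrite lexx andbT !ler_pM2l// ler_pM2r.
have [t2|t2] := leP t gamma2^-1.
  rewrite -[X in _ <= X <= _]mulr1 !ler_pM2l//.
  by rewrite mulrC -ler_pdivlMr// div1r t2 mulrC -ler_pdivrMr// div1r.
by rewrite lexx/= !ler_pM2l// ler_pM2r.
Qed.

Lemma tr_radius0 : tr_radius alpha gamma1 gamma2 0 = 0.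
Proof.
by rewrite /tr_radius invr_gt0 (lt_le_trans gamma2_gt0 gamma_le) mulr0.
Qed.

Lemma tr_step_bounds g mu mu_min : g != 0 ->
  mu_min <= mu -> mu_min <= gamma2 * alpha ->
  mu_min <= tr_step (tr_radius alpha gamma1 gamma2 (enorm g)) mu g
    <= alpha * gamma1.
Proof.
move=> g0 mu_ge mu_min_le.
have gp : 0 < enorm g by rewrite lt_def enorm_eq0 g0 enorm_ge0.
have /andP[lo hi] := tr_radius_bounds gp.
by rewrite /tr_step le_min ge_min mu_ge hi orbT andbT (le_trans _ lo)// mulrC.
Qed.

End trust_region_step.

(** * Pointwise consequences of the quadratic upper bound on [f] *)

Section descent.
Context (R : realType) (n : nat) (f : 'rV[R]_n -> R) (fstar L : R).
Hypotheses (L_gt0 : 0 < L) (f_lower : forall y, fstar <= f y)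
  (f_smooth : forall y z : 'rV[R]_n,
     f y <= f z + dotp (grad f z) (y - z) + L / 2 * enorm (y - z) ^+ 2).

(* A gradient step of length [1 / L] from [y] cannot go below [fstar]. *)
Lemma sqr_grad_le y : enorm (grad f y) ^+ 2 <= 2 * L * (f y - fstar).
Proof.
have := f_smooth (y - L^-1 *: grad f y) y.
have := f_lower (y - L^-1 *: grad f y).
rewrite [X in dotp _ X]addrC [X in enorm X]addrC !addKr -scaleNr.
rewrite enormZ_sqr dotpZr -enorm_sqr sqrrN.
set e := enorm _ ^+ 2 => h1 h2; have {h1 h2} := le_trans h1 h2.
have -> : f y + - L^-1 * e + L / 2 * (L^-1 ^+ 2 * e) = f y - e / (2 * L).
  by field; rewrite gt_eqF.
by rewrite lerBrDr addrC -lerBrDr ler_pdivrMr ?mulr_gt0// mulrC.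
Qed.

(* The step length [s] ranges in [lo, hi], so writing [- s = - hi + (hi - s)]
   leaves a cross term with a nonnegative bounded factor, which Young's
   inequality controls. *)
Lemma descent_step (x g : 'rV[R]_n) (lo hi s c : R) :
  0 < lo -> lo <= s <= hi -> 0 < c ->
  f (x - s *: g) <= f x - hi * dotp (grad f x) g
    + (hi - lo) * (2^-1 * (c * enorm (grad f x) ^+ 2 + enorm g ^+ 2 / c))
    + L / 2 * (hi ^+ 2 * enorm g ^+ 2).
Proof.
move=> lo0 /andP[los shi] c0; have := f_smooth (x - s *: g) x.
rewrite [X in dotp _ X]addrC [X in enorm X]addrC !addKr -scaleNr.
rewrite enormZ_sqr dotpZr sqrrN => /le_trans; apply.
have := young (grad f x) g c0.
set Y := 2^-1 * _ => Gg.
(* Nonnegativity of [Y] allows the factor [hi - s] to be enlarged to [hi - lo], which removes [s]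
   from the bound. *)
have Y0 : 0 <= Y.
  rewrite mulr_ge0 ?invr_ge0// addr_ge0//.
    by rewrite mulr_ge0 ?sqr_ge0// ltW.
  by rewrite divr_ge0 ?sqr_ge0// ltW.
have h1 : (hi - s) * dotp (grad f x) g <= (hi - lo) * Y.
  apply: le_trans (_ : (hi - s) * Y <= _).
    by rewrite ler_wpM2l// subr_ge0.
  by rewrite ler_wpM2r// lerB.
have h2 : s ^+ 2 * enorm g ^+ 2 <= hi ^+ 2 * enorm g ^+ 2.
  have s0 : 0 <= s by exact: le_trans (ltW lo0) los.
  by rewrite ler_wpM2r ?sqr_ge0// ler_sqr// nnegrE (le_trans s0).
have h3 := ler_wpM2l (ltW (divr_gt0 L_gt0 (ltr0Sn R 1))) h2.
move: h1 h3; lra.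
Qed.

End descent.
(** * Functions of a random vector *)

Section sigma_vector.
Context (T : pointedType) (R : realType) (n : nat) (X : T -> 'rV[R]_n).

Local Notation sigma_vectorType := (g_sigma_algebraType
  (\big[setU/set0]_(i < n)
     preimage_set_system setT (fun w => X w 0 i) (@measurable _ R))).

Lemma sigma_vectorE (A : set T) :
  sigma_vector X A = measurable (A : set sigma_vectorType).
Proof. by []. Qed.

Lemma sigma_vector_coord (i : 'I_n) (A : set R) : measurable A ->
  sigma_vector X ((fun w => X w 0 i) @^-1` A).
Proof.
move=> mA; apply: sub_sigma_algebra; rewrite (bigD1 i)//=; left.
by exists A => //; rewrite setTI.
Qed.

(** Balls of the sup norm are products of intervals, so the preimage is a finite intersection of
    coordinate preimages. *)
Lemma sigma_vector_ball (y : 'rV[R]_n) (e : R) : 0 < e ->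
  sigma_vector X (X @^-1` ball y e).
Proof.
move=> e0; rewrite (_ : _ @^-1` _ =
    \bigcap_(i in [set: 'I_n]) (fun w => X w 0 i) @^-1` ball (y 0 i) e).
  rewrite sigma_vectorE; apply: fin_bigcap_measurable => // i _.
  rewrite -sigma_vectorE; apply: sigma_vector_coord.
  by apply: open_measurable; exact: ball_open.
apply/seteqP; split => [w [_ Xw] i _|w Xw]; first exact: Xw.
by split => // i j; rewrite ord1; exact: Xw.
Qed.

(** Second countability: [U] is the union of the countably many balls with rational centre and
    radius [m.+1%:R^-1] that it contains. *)
Lemma sigma_vector_open (U : set 'rV[R]_n) : open U ->
  sigma_vector X (X @^-1` U).
Proof.
move=> oU.
pose ctr (q : 'rV[rat]_n) : 'rV[R]_n := map_mx ratr q.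
pose I := ('rV[rat]_n * nat)%type.
pose F (q : I) : set T := if `[< ball (ctr q.1) q.2.+1%:R^-1 `<=` U >]
  then X @^-1` ball (ctr q.1) q.2.+1%:R^-1 else set0.
rewrite (_ : _ @^-1` _ = \bigcup_q F q).
  rewrite sigma_vectorE; apply: countable_bigcupT_measurable => [|q].
    exact: countableP.
  rewrite /F; case: ifPn => // _; rewrite -sigma_vectorE.
  exact: sigma_vector_ball.
apply/seteqP; split => [w Uw|w [q _]]; last first.
  by rewrite /F; case: ifPn => // /asboolP; apply.
have [e /= e0 eU] : exists2 e : R, 0 < e & ball (X w) e `<=` U.
  by move: oU; rewrite openE => /(_ _ Uw)/nbhs_ballP.
(* Twice the radius is then below [e], so such a ball containing [X w] stays inside
   [ball (X w) e]. *)
pose m := Num.truncn (2 / e).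
have me : m.+1%:R^-1 * 2 < e.
  by rewrite mulrC ltr_pdivrMr// -ltr_pdivrMl// mulrC truncnS_gt.
have m0 : 0 < m.+1%:R^-1 :> R by rewrite invr_gt0.
have /choice[q Xq] (i : 'I_n) : exists r : rat,
    `|ratr r - X w 0 i| < m.+1%:R^-1.
  have /rat_in_itvoo[r] : X w 0 i - m.+1%:R^-1 < X w 0 i + m.+1%:R^-1.
    by rewrite ltrD2l (lt_trans _ m0)// oppr_lt0.
  by rewrite in_itv/= => rX; exists r; rewrite ltr_distl.
have wq : ball (ctr (\row_i q i)) m.+1%:R^-1 (X w).
  by split => // i j; rewrite ord1 !mxE; exact: Xq.
exists (\row_i q i, m) => //=; rewrite /F/= asboolT// => z qz.
apply: eU; apply: le_ball (ltW me) _ _.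
rewrite mulr_natr mulr2n; apply: ball_triangle qz; exact: ball_sym.
Qed.

(** Open intervals generate the Borel sets of [R], and their preimages under [h] are open. This is
    what makes the coordinates of the gradient at [x k] measurable for [sigma_vector (x k)]. *)
Lemma continuous_sigma_vector (h : 'rV[R]_n -> R) : continuous h ->
  preimage_set_system setT (h \o X) measurable `<=` sigma_vector X.
Proof.
move=> /continuousP ch _ [B mB <-].
have : measurable_fun setT ((h \o X) : sigma_vectorType -> R).
  apply: (measurability _ (RGenOpens.measurableE R)).
  move=> _ [_ [a [b ->] <-]]; rewrite -sigma_vectorE setTI comp_preimage.
  by apply: sigma_vector_open; apply: ch; exact: interval_open.
by move=> /(_ measurableT _ mB).
Qed.

End sigma_vector.

Lemma sigma_vector_measurable d (T : measurableType d) (R : realType) (n : nat)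
  (X : T -> 'rV[R]_n) : random_vector X -> sigma_vector X `<=` measurable.
Proof.
move=> mX; apply: smallest_sub; first exact: sigma_algebra_measurable.
elim/big_rec: _ => [//|i B _ BX]; rewrite subUset; split => // _ [A mA <-].
exact: mX.
Qed.

Lemma continuous_random_vector d (T : measurableType d) (R : realType)
    (n : nat) (X : T -> 'rV[R]_n) (h : 'rV[R]_n -> R) :
  random_vector X -> continuous h -> measurable_fun setT (fun w => h (X w)).
Proof.
move=> mX ch _ B mB; apply: (sigma_vector_measurable mX).
by apply: (continuous_sigma_vector ch); exists B.
Qed.

(** * Pulling measurable factors out of conditional expectations *)

Section pull_out_ge0.
Context d (T : measurableType d) (R : realType) (P : probability T R).
Implicit Types (G : set (set T)) (W X Y Z : T -> R).

Import HBNNSimple.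

Lemma sub_measurable_fun G Z : G `<=` measurable ->
  preimage_set_system setT Z measurable `<=` G -> measurable_fun setT Z.
Proof. by move=> sG ZG _ B mB; apply: sG; apply: ZG; exists B. Qed.

(** Decomposing [phi] over its values leaves integrals of [W] over level sets of [phi \o Z]; when
    [Z] is measurable for [G], these are sets on which conditional expectations are tested. *)
Lemma integral_nnsfun_compM (phi : {nnsfun R >-> R}) Z W :
  measurable_fun setT Z -> measurable_fun setT W -> (forall w, 0 <= W w) ->
  (\int[P]_w (phi (Z w) * W w)%:E = \sum_(y \in range phi)
     (y%:E * \int[P]_(w in Z @^-1` (phi @^-1` [set y])) (W w)%:E))%E.
Proof.
move=> mZ mW W0.
have mA y : measurable (Z @^-1` (phi @^-1` [set y])).
  by rewrite -[X in measurable X]setTI; apply: mZ.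
have indE y w : \1_(phi @^-1` [set y]) (Z w) =
    \1_(Z @^-1` (phi @^-1` [set y])) w :> R by rewrite !indicE.
under eq_integral => w _.
  rewrite fimfunE mulr_fsuml// -fsumEFin//.
  under eq_fsbigr do rewrite indE.
  over.
rewrite /= ge0_integral_fsum//; last 2 first.
- move=> y; apply/measurable_EFinP/measurable_funM => //.
  exact/measurable_funM/measurable_indic.
- move=> y w _; rewrite lee_fin mulr_ge0// -indE -lee_fin.
  by rewrite EFinM nnfun_muleindic_ge0.
apply: eq_fsbigr => y /set_mem[r _ <-].
rewrite [in RHS]integral_mkcond/= -ge0_integralZl_EFin//.
- apply: eq_integral => w _; rewrite patchE indicE.
  by case: (_ \in _); rewrite ?(mulr1, mulr0) ?mul0r ?mule0// EFinM.
- by move=> w _; rewrite patchE; case: ifPn => _; rewrite ?lee_fin.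
- apply/(measurable_restrictT _ _).1 => //; apply: measurable_funTS.
  exact/measurable_EFinP.
Qed.

(** Monotone convergence. The approximants are those of the positive part of the identity on [R], so
    that after composition they remain functions of [Z]. *)
Lemma cvg_integral_nnsfun_approxM Z W :
  measurable_fun setT Z -> measurable_fun setT W ->
  (forall w, 0 <= Z w) -> (forall w, 0 <= W w) ->
  let phi := nnsfun_approx measurableT
    (measurable_funepos (@EFin_measurable R setT)) in
  (\int[P]_w (phi k (Z w) * W w)%:E @[k --> \oo]
     --> \int[P]_w (Z w * W w)%:E)%E.
Proof.
move=> mZ mW Z0 W0 phi.
have phiZ w : EFin \o phi^~ (Z w) @ \oo --> (Z w)%:E.
  have := @cvg_nnsfun_approx _ _ _ _ measurableT _
    (measurable_funepos (@EFin_measurable R setT)) _ (Z w) Logic.I.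
  rewrite funeposE/= max_l ?lee_fin//; apply=> r _.
  by rewrite funeposE le_max lexx orbT.
rewrite [X in _ --> X](_ : _ =
    (\int[P]_w limn (fun k => (phi k (Z w) * W w)%:E))%E); last first.
  apply: eq_integral => w _; apply/esym/cvg_lim => //.
  by rewrite EFinM; exact: (cvgeZr _ (phiZ w)).
apply: cvg_monotone_convergence => //.
- move=> k; apply/measurable_EFinP/measurable_funM => //.
  exact: measurableT_comp.
- by move=> k w _; rewrite lee_fin mulr_ge0.
- move=> w _ k l kl; rewrite lee_fin ler_wpM2r//.
  exact/lefP/nd_nnsfun_approx.
Qed.

(** The two sides agree for simple functions of [Z], by the defining property on level sets, and
    both pass to the limit in the extended reals. *)
Lemma condexp_ge0_pull_out G X Y Z : G `<=` measurable ->
  is_condexp_ge0 P G X Y ->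
  (forall w, 0 <= Z w) -> preimage_set_system setT Z measurable `<=` G ->
  (\int[P]_w (Z w * Y w)%:E = \int[P]_w (Z w * X w)%:E)%E.
Proof.
move=> sG [mX X0 Y0 YG YE] Z0 ZG.
have mY := sub_measurable_fun sG YG; have mZ := sub_measurable_fun sG ZG.
have /cvg_lim <- // := cvg_integral_nnsfun_approxM mZ mY Z0 Y0.
have /cvg_lim <- // := cvg_integral_nnsfun_approxM mZ mX Z0 X0.
congr (limn _); apply/funext => k; rewrite !integral_nnsfun_compM//.
apply: eq_fsbigr => y _; congr (_ * _)%E; apply: YE; apply: ZG.
set phi := (X in X @^-1` [set y]).
by exists (phi @^-1` [set y]); rewrite ?setTI.
Qed.

End pull_out_ge0.

(** * Extension of the pull-out property to signed factors and variables *)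

Section pull_out.
Context d (T : measurableType d) (R : realType) (P : probability T R).
Context (G : set (set T)) (sG : G `<=` measurable).
Implicit Types (X Y Z u v : T -> R).

Local Notation integ u := (P.-integrable setT (EFin \o u)).

Lemma integrable_le u v : measurable_fun setT u ->
  (forall w, `|u w| <= `|v w|) -> integ v -> integ u.
Proof.
move=> mu uv; apply: le_integrable => //; first exact/measurable_EFinP.
by move=> w _ /=; rewrite lee_fin.
Qed.

Lemma integrable_sub u v : integ u -> integ v -> integ (u \- v).
Proof. by move=> iu iv; have := integrableB measurableT iu iv. Qed.

Lemma integrable_add u v : integ u -> integ v -> integ (u \+ v).
Proof. by move=> iu iv; have := integrableD measurableT iu iv. Qed.

Lemma integrable_scale (k : R) u : integ u -> integ (fun w => k * u w).
Proof. by move=> iu; have := integrableZl measurableT k iu. Qed.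

Lemma integrable_measurable u : integ u -> measurable_fun setT u.
Proof. by move=> /measurable_int/measurable_EFinP. Qed.

Lemma condexp_ge0_measurable X Y : is_condexp_ge0 P G X Y ->
  measurable_fun setT X /\ measurable_fun setT Y.
Proof. by move=> [mX _ _ YG _]; split => //; exact: sub_measurable_fun YG. Qed.

Let sub_comp Z (h : R -> R) : measurable_fun setT h ->
  preimage_set_system setT Z measurable `<=` G ->
  preimage_set_system setT (h \o Z) measurable `<=` G.
Proof.
move=> mh ZG _ [B mB <-]; apply: ZG; exists (h @^-1` B) => //.
by rewrite -[X in measurable X]setTI; exact: mh.
Qed.

Let funrpos_normr Z w : `|Z^\+ w| <= `|Z w|.
Proof.
by rewrite /funrpos ger0_norm ?le_max ?lexx ?orbT// ge_max ler_norm normr_ge0.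
Qed.

Let funrneg_normr Z w : `|Z^\- w| <= `|Z w|.
Proof.
rewrite /funrneg ger0_norm ?le_max ?lexx ?orbT// ge_max normr_ge0 -normrN.
by rewrite ler_norm.
Qed.

(** The positive and negative parts of [Z] are again measurable for [G] and dominated by [Z] in
    absolute value, so each falls under the nonnegative case. *)
Lemma condexp_ge0_integral X Y Z : is_condexp_ge0 P G X Y ->
  preimage_set_system setT Z measurable `<=` G ->
  integ (Z \* X) -> integ (Z \* Y) /\
    \int[P]_w (Z w * Y w) = \int[P]_w (Z w * X w).
Proof.
move=> XY ZG iZX; have [mX mY] := condexp_ge0_measurable XY.
(* The extended-real identity serves twice: it transfers finiteness from [U \* X] to [U \* Y], and
   then gives equality of the real integrals. *)
have ge0_case (U : T -> R) : (forall w, 0 <= U w) ->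
    preimage_set_system setT U measurable `<=` G -> integ (U \* X) ->
    integ (U \* Y) /\ \int[P]_w (U w * Y w) = \int[P]_w (U w * X w).
  move=> U0 UG iUX; have UE := condexp_ge0_pull_out sG XY U0 UG.
  have mU := sub_measurable_fun sG UG; case: (XY) => _ X0 Y0 _ _.
  split; last by rewrite /Rintegral UE.
  apply/integrableP; split; first exact/measurable_EFinP/measurable_funM.
  under eq_integral do rewrite /= ger0_norm ?mulr_ge0//.
  rewrite UE; have /integrableP[_] := iUX.
  by under eq_integral do rewrite /= ger0_norm ?mulr_ge0//.
have mZ := sub_measurable_fun sG ZG.
have [iYp Ep] : integ (Z^\+ \* Y) /\
    \int[P]_w (Z^\+ w * Y w) = \int[P]_w (Z^\+ w * X w).
  apply: ge0_case => [w||].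
  - exact: funrpos_ge0.
  - exact: (sub_comp (measurable_funrpos (@measurable_id _ R setT))).
  - apply: integrable_le iZX => [|w /=].
      exact/measurable_funM/mX/measurable_funrpos.
    by rewrite !normrM ler_wpM2r.
have [iYn En] : integ (Z^\- \* Y) /\
    \int[P]_w (Z^\- w * Y w) = \int[P]_w (Z^\- w * X w).
  apply: ge0_case => [w||].
  - exact: funrneg_ge0.
  - exact: (sub_comp (measurable_funrneg (@measurable_id _ R setT))).
  - apply: integrable_le iZX => [|w /=].
      exact/measurable_funM/mX/measurable_funrneg.
    by rewrite !normrM ler_wpM2r.
have ZE w : Z w = Z^\+ w - Z^\- w by rewrite -[in LHS](funrposBneg Z).
have ZME (V : T -> R) : Z \* V = (Z^\+ \* V) \- (Z^\- \* V).
  by apply/funext => w; rewrite /= -mulrBl -ZE.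
have iXp : integ (Z^\+ \* X).
  apply: integrable_le iZX => [|w /=].
    exact/measurable_funM/mX/measurable_funrpos.
  by rewrite !normrM ler_wpM2r.
have iXn : integ (Z^\- \* X).
  apply: integrable_le iZX => [|w /=].
    exact/measurable_funM/mX/measurable_funrneg.
  by rewrite !normrM ler_wpM2r.
split; first by rewrite ZME; exact: integrable_sub.
rewrite -[LHS]/(\int[P]_w (Z \* Y) w) -[RHS]/(\int[P]_w (Z \* X) w) !ZME.
by rewrite !RintegralB//= Ep En.
Qed.

Lemma condexp_integral X Y Z : is_condexp P G X Y ->
  preimage_set_system setT Z measurable `<=` G ->
  integ (Z \* X) -> integ (Z \* Y) /\
    \int[P]_w (Z w * Y w) = \int[P]_w (Z w * X w).
Proof.
move=> [Yp [Yn [XYp XYn YE]]] ZG iZX; have mZ := sub_measurable_fun sG ZG.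
have iZXp : integ (Z \* X^\+).
  apply: integrable_le iZX => [|w /=].
    by apply: measurable_funM => //; case: (condexp_ge0_measurable XYp).
  by rewrite !normrM ler_wpM2l.
have iZXn : integ (Z \* X^\-).
  apply: integrable_le iZX => [|w /=].
    by apply: measurable_funM => //; case: (condexp_ge0_measurable XYn).
  by rewrite !normrM ler_wpM2l.
have [iYp Ep] := condexp_ge0_integral XYp ZG iZXp.
have [iYn En] := condexp_ge0_integral XYn ZG iZXn.
have -> : Z \* Y = (Z \* Yp) \- (Z \* Yn).
  by apply/funext => w; rewrite /= YE mulrBr.
split; first exact: integrable_sub.
under [LHS]eq_Rintegral do rewrite YE mulrBr.
have XE w : X w = X^\+ w - X^\- w by rewrite -[in LHS](funrposBneg X).
under [RHS]eq_Rintegral do rewrite XE mulrBr.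
by rewrite !RintegralB//= Ep En.
Qed.

End pull_out.

(** * Comparison of real-valued integrals under almost sure inequalities *)

Section real_integrals.
Context d (T : measurableType d) (R : realType) (P : probability T R).
Implicit Types u v : T -> R.

Local Notation integ u := (P.-integrable setT (EFin \o u)).

Lemma integrable_sum_Rintegral (I : Type) (s : seq I) (u : I -> T -> R) :
  (forall i, integ (u i)) ->
  integ (fun w => \sum_(i <- s) u i w) /\
    \int[P]_w (\sum_(i <- s) u i w) = \sum_(i <- s) \int[P]_w u i w.
Proof.
move=> iu; elim: s => [|i s [IHi IHe]].
  have -> : (fun w => \sum_(i <- [::]) u i w) = cst 0.
    by apply/funext => w; rewrite big_nil.
  by rewrite big_nil Rintegral_cst// mul0r; split => //; exact: integrable0.
have -> : (fun w => \sum_(j <- i :: s) u j w) =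
    u i \+ (fun w => \sum_(j <- s) u j w).
  by apply/funext => w; rewrite big_cons.
by split; [exact: integrable_add|rewrite RintegralD// big_cons IHe].
Qed.

(** The function [u \max v] equals [v] almost everywhere and dominates [u] everywhere, which reduces
    the claim to a pointwise comparison. *)
Lemma ae_le_Rintegral u v : integ u -> integ v ->
  {ae P, forall w, u w <= v w} -> \int[P]_w u w <= \int[P]_w v w.
Proof.
move=> iu iv uv.
have mu := integrable_measurable iu; have mv := integrable_measurable iv.
have mM : measurable_fun setT (u \max v) by exact: measurable_maxr.
have iM : integ (u \max v).
  apply: (@integrable_le _ _ _ _ _ (fun w => `|u w| + `|v w|)) => // [w /=|].
    rewrite [leRHS]ger0_norm ?addr_ge0// /Num.max; case: ifP => _.
      by rewrite lerDr.
    by rewrite lerDl.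
  by apply: integrable_add; [move: iu|move: iv] => /integrable_norm.
have -> : \int[P]_w v w = \int[P]_w (u \max v) w.
  congr fine; apply: ae_eq_integral => //; try exact/measurable_EFinP.
  by move: uv; apply: filterS => w uvw _; rewrite /= max_r.
by apply: le_Rintegral => // w _; rewrite le_max lexx.
Qed.

(* The negative part of a version of the conditional expectation of [X >= 0]
   has zero integral, hence only its positive part contributes. *)
Lemma condexp_le_Rintegral (G : set (set T)) (X Y V : T -> R) :
  G `<=` measurable -> G setT ->
  is_condexp P G X Y -> (forall w, 0 <= X w) ->
  integ V -> (forall w, 0 <= V w) -> {ae P, forall w, Y w <= V w} ->
  integ X /\ \int[P]_w X w <= \int[P]_w V w.
Proof.
move=> sG GT [Yp [Yn [XYp XYn YE]]] X0 iV V0 YV.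
have [_ mYp] := condexp_ge0_measurable sG XYp.
have [_ mYn] := condexp_ge0_measurable sG XYn.
have mV := integrable_measurable iV.
case: XYp => mXp _ Yp0 _ /(_ setT GT) Ep.
case: XYn => _ _ Yn0 _ /(_ setT GT) En.
have XpE : X^\+ = X by apply/funext => w; rewrite /funrpos max_l.
have XnE : X^\- = cst 0.
  by apply/funext => w; rewrite /funrneg max_r// oppr_le0.
rewrite XpE in mXp Ep; rewrite XnE integral0 in En.
have XV : (\int[P]_w (X w)%:E <= \int[P]_w (V w)%:E)%E.
  (* Adding the vanishing integral of [Yn] on the right reduces the claim to [Yp <= V + Yn] almost
     everywhere, a rearrangement of [Y <= V]. *)
  rewrite -Ep -[leRHS]adde0 -En -ge0_integralD//; last 4 first.
  - by move=> w _; rewrite lee_fin.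
  - exact/measurable_EFinP.
  - by move=> w _; rewrite lee_fin.
  - exact/measurable_EFinP.
  apply: ae_ge0_le_integral => //.
  - by move=> w _; rewrite lee_fin.
  - exact/measurable_EFinP.
  - by move=> w _; rewrite adde_ge0// lee_fin.
  - by apply: emeasurable_funD; exact/measurable_EFinP.
  move: YV; apply: filterS => w; rewrite YE => h _.
  by rewrite -EFinD lee_fin -lerBlDr.
have iX : integ X.
  apply/integrableP; split; first exact/measurable_EFinP.
  under eq_integral do rewrite /= ger0_norm//.
  apply: le_lt_trans XV _; have /integrableP[_] := iV.
  by under eq_integral do rewrite /= ger0_norm//.
split => //; apply: fine_le => //; exact: integrable_fin_num.
Qed.

End real_integrals.

(** * Measurability of the step length *)

Section measurability_step.
Context (R : realType) (n : nat).

Lemma measurable_tr_radius (alpha gamma1 gamma2 : R) :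
  measurable_fun setT (tr_radius alpha gamma1 gamma2).
Proof.
apply: measurable_fun_ifT => //; first exact: measurable_fun_ltr.
by apply: measurable_fun_ifT => //; exact: measurable_fun_ler.
Qed.

Context d (T : measurableType d) (g : T -> 'rV[R]_n).
Hypothesis mg : random_vector g.

Lemma measurable_enorm : measurable_fun setT (fun w => enorm (g w)).
Proof.
have msqrt : measurable_fun setT (@Num.sqrt R).
  by apply: continuous_measurable_fun; exact: sqrt_continuous.
apply: (measurableT_comp msqrt).
by apply: measurable_sum => i; exact: measurable_funM.
Qed.

Lemma measurable_tr_step (alpha gamma1 gamma2 : R) (mu : T -> R) :
  measurable_fun setT mu ->
  measurable_fun setT (fun w =>
    tr_step (tr_radius alpha gamma1 gamma2 (enorm (g w))) (mu w) (g w)).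
Proof.
move=> mmu; apply: measurable_minr => //; apply: measurable_funM.
  exact: measurableT_comp (measurable_tr_radius _ _ _) measurable_enorm.
(* On nonnegative reals inversion, with value [0] at [0], is the real power of exponent [-1], which
   is measurable. *)
rewrite (_ : (fun w => _) = fun w => enorm (g w) `^ (-1)); last first.
  by apply/funext => w; rewrite powR_inv1// enorm_ge0.
have mpow : measurable_fun setT (@powR R ^~ (-1)) by exact: measurable_powR.
exact: (measurableT_comp mpow measurable_enorm).
Qed.

End measurability_step.
(** * Descent in expectation *)

Section expected_descent.
Context d (T : measurableType d) (R : realType) (P : probability T R) (n : nat).
Context (f : 'rV[R]_n -> R) (fstar L : R).
Hypotheses (fC1 : cont_diff f) (f_lower : forall y, fstar <= f y)
  (L_gt0 : 0 < L) (f_smooth : forall y z : 'rV[R]_n,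
     f y <= f z + dotp (grad f z) (y - z) + L / 2 * enorm (y - z) ^+ 2).
Context (x g x' Eg : T -> 'rV[R]_n) (Eg2 : T -> R) (omega M1 M2 lo hi : R).
Hypotheses (mx : random_vector x) (mg : random_vector g)
  (mx' : random_vector x').
Hypotheses (EgE : is_condexp_vector P (sigma_vector x) g Eg)
  (Eg2E : is_condexp P (sigma_vector x) (fun w => enorm (g w) ^+ 2) Eg2).
Hypotheses (M1_gt0 : 0 < M1) (M2_gt0 : 0 < M2).
Hypothesis g_mean : {ae P, forall w,
  omega * enorm (grad f (x w)) ^+ 2 <= dotp (grad f (x w)) (Eg w)}.
Hypothesis g_second_moment : {ae P, forall w,
  Eg2 w <= M1 + M2 * enorm (grad f (x w)) ^+ 2}.
Hypotheses (lo_gt0 : 0 < lo) (lo_le_hi : lo <= hi)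
  (step : forall w, exists2 s, lo <= s <= hi & x' w = x w - s *: g w).

Local Notation integ u := (P.-integrable setT (EFin \o u)).
Local Notation G := (fun w => grad f (x w)).

Let f_continuous : continuous f.
Proof. by case: fC1 => df _ y; exact: differentiable_continuous (df y). Qed.

Let grad_continuous i : continuous (fun y => grad f y 0 i).
Proof.
move=> y; apply: (continuous_comp (f := grad f) (g := fun v => v 0 i)).
  by case: fC1 => _; exact.
exact: coord_continuous.
Qed.

Let random_grad : random_vector G.
Proof. move=> i; exact: continuous_random_vector mx (@grad_continuous i). Qed.

Let sub_sigma : sigma_vector x `<=` measurable.
Proof. exact: sigma_vector_measurable. Qed.

Let measurable_sqr (v : T -> 'rV[R]_n) : random_vector v ->
  measurable_fun setT (fun w => enorm (v w) ^+ 2).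
Proof. by move=> mv; apply: measurable_funX; exact: measurable_enorm. Qed.

Lemma integrable_sqr_grad : integ (fun w => f (x w)) ->
  integ (fun w => enorm (G w) ^+ 2).
Proof.
move=> ifx.
have iV : integ (fun w => 2 * L * (f (x w) - fstar)).
  apply: integrable_scale; apply: integrable_sub => //.
  exact: finite_measure_integrable_cst.
apply: integrable_le iV => [|w]; first exact: measurable_sqr.
rewrite !ger0_norm ?sqr_ge0//; last first.
  by rewrite !mulr_ge0// ?subr_ge0// ltW.
exact: sqr_grad_le.
Qed.

Lemma sqr_stoch_grad_Rintegral : integ (fun w => enorm (G w) ^+ 2) ->
  integ (fun w => enorm (g w) ^+ 2) /\
    \int[P]_w (enorm (g w) ^+ 2) <= M1 + M2 * \int[P]_w (enorm (G w) ^+ 2).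
Proof.
move=> iG.
have iM1 : integ (fun=> M1) by exact: finite_measure_integrable_cst.
have iM2 : integ (fun w => M2 * enorm (G w) ^+ 2) by exact: integrable_scale.
have iV := integrable_add iM1 iM2.
have [||//|ig le_g] :=
  condexp_le_Rintegral sub_sigma _ Eg2E (fun w => sqr_ge0 _) iV.
- by rewrite sigma_vectorE; exact: measurableT.
- by move=> w /=; rewrite addr_ge0 ?(ltW M1_gt0)// mulr_ge0 ?sqr_ge0 ?ltW.
- split => //; apply: le_trans le_g _.
  rewrite RintegralD// RintegralZl// Rintegral_cst//.
  by rewrite /= probability_setT mulr1.
Qed.

(** Each coordinate of [G] is a continuous function of [x], so it can be pulled out of the
    conditional expectation of the same coordinate of [g]; the products are integrable because both
    squares are. *)
Lemma dotp_stoch_grad_Rintegral : integ (fun w => enorm (G w) ^+ 2) ->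
  integ (fun w => enorm (g w) ^+ 2) ->
  integ (fun w => dotp (G w) (g w)) /\
    omega * \int[P]_w (enorm (G w) ^+ 2) <= \int[P]_w dotp (G w) (g w).
Proof.
move=> iG ig.
have coord_le (v : 'rV[R]_n) i : v 0 i ^+ 2 <= enorm v ^+ 2.
  rewrite enorm_sqr /dotp (bigD1 i)//= -expr2 lerDl sumr_ge0// => j _.
  by rewrite -expr2 sqr_ge0.
have iGg i : integ ((fun w => G w 0 i) \* (fun w => g w 0 i)).
  apply: integrable_le (integrable_add iG ig) => [|w /=].
    exact: measurable_funM (random_grad i) (mg i).
  rewrite [leRHS]ger0_norm ?addr_ge0 ?sqr_ge0// normrM.
  apply: le_trans (lerD (coord_le (G w) i) (coord_le (g w) i)).
  rewrite -(real_normK (num_real (G w 0 i))) -(real_normK (num_real (g w 0 i))).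
  have := sqr_ge0 (`|G w 0 i| - `|g w 0 i|).
  have := mulr_ge0 (normr_ge0 (G w 0 i)) (normr_ge0 (g w 0 i)).
  rewrite sqrrB; lra.
have pull i := condexp_integral sub_sigma (EgE i)
  (continuous_sigma_vector (X := x) (@grad_continuous i)) (iGg i).
have [iGg' EGg] := integrable_sum_Rintegral (index_enum 'I_n) iGg.
have [iGE' EGE] :=
  integrable_sum_Rintegral (index_enum 'I_n) (fun i => (pull i).1).
split => //.
have -> : \int[P]_w dotp (G w) (g w) = \int[P]_w dotp (G w) (Eg w).
  rewrite -[LHS]/(Rintegral _ _ _) EGg [RHS]EGE.
  by apply: eq_bigr => i _; rewrite (pull i).2.
rewrite -RintegralZl//; apply: ae_le_Rintegral => //.
exact: integrable_scale.
Qed.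

Lemma expected_descent : integ (fun w => f (x w)) ->
  let t := \int[P]_w (enorm (G w) ^+ 2) in
  let h1 := 2^-1 * Num.sqrt M1 in
  let h2 := h1 + Num.sqrt M2 in
  integ (fun w => f (x' w)) /\
    \int[P]_w f (x' w) <= \int[P]_w f (x w) - hi * (omega * t)
      + (hi - lo) * (h1 + h2 * t) + L / 2 * (hi ^+ 2 * (M1 + M2 * t)).
Proof.
move=> ifx t h1 h2.
have iG := integrable_sqr_grad ifx.
have [ig le_g] := sqr_stoch_grad_Rintegral iG.
have [iGg le_Gg] := dotp_stoch_grad_Rintegral iG ig.
rewrite -/t in le_g le_Gg.
have t0 : 0 <= t by apply: Rintegral_ge0 => w _; exact: sqr_ge0.
pose s1 := Num.sqrt M1; pose s2 := Num.sqrt M2.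
have s1_gt0 : 0 < s1 by rewrite sqrtr_gt0.
have s2_gt0 : 0 < s2 by rewrite sqrtr_gt0.
(* With this weight, Young's inequality gives exactly [h1 + h2 * t]. *)
pose c := s1 + s2.
have c_gt0 : 0 < c by exact: addr_gt0.
pose a := (hi - lo) * (2^-1 * c).
pose b := (hi - lo) * (2^-1 / c) + L / 2 * hi ^+ 2.
pose B w := f (x w) - hi * dotp (G w) (g w)
  + (a * enorm (G w) ^+ 2 + b * enorm (g w) ^+ 2).
have f_le w : f (x' w) <= B w.
  have [s sb ->] := step w.
  apply: le_trans (descent_step L_gt0 f_smooth (x w) (g w) lo_gt0 sb c_gt0) _.
  rewrite le_eqVlt; apply/orP; left; apply/eqP; rewrite /B /a /b; ring.
have i1 := integrable_scale hi iGg.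
have i2 := integrable_scale a iG.
have i3 := integrable_scale b ig.
have iB : integ B.
  by apply: integrable_add; [exact: integrable_sub|exact: integrable_add].
have EB : \int[P]_w B w = \int[P]_w f (x w)
    - hi * \int[P]_w dotp (G w) (g w)
    + (a * t + b * \int[P]_w (enorm (g w) ^+ 2)).
  rewrite RintegralD//; [|exact: integrable_sub|exact: integrable_add].
  by rewrite RintegralB// RintegralD// !RintegralZl.
(* The values [f (x' w)] lie between [fstar] and the integrable [B w]. *)
have ifx' : integ (fun w => f (x' w)).
  apply: (@integrable_le _ _ _ _ _ (fun w => `|B w| + `|fstar|)) => [|w /=|].
  - exact: continuous_random_vector mx' f_continuous.
  - rewrite [leRHS]ger0_norm ?addr_ge0// ler_norml.
    have := f_le w; have := f_lower (x' w).
    have := ler_norm (B w); have := ler_norm (- fstar); rewrite normrN.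
    have := normr_ge0 (B w); have := normr_ge0 fstar; lra.
  - apply: integrable_add; first by move: iB => /integrable_norm.
    exact: finite_measure_integrable_cst.
split => //.
apply: le_trans (le_Rintegral measurableT ifx' iB (fun w _ => f_le w)) _.
rewrite EB.
set m := Rintegral _ _ _ in le_g *; set q := Rintegral _ _ _ in le_Gg *.
have hi0 : 0 < hi by exact: lt_le_trans lo_le_hi.
have le_q := ler_wpM2l (ltW hi0) le_Gg.
have le_m : L / 2 * (hi ^+ 2 * m) <= L / 2 * (hi ^+ 2 * (M1 + M2 * t)).
  by rewrite !ler_wpM2l ?sqr_ge0// divr_ge0 ?ltW.
(* Here [m] is the mean of the squared norm of [g]. The bound [m / c <= s1 + s2 * t] holds because
   [c * (s1 + s2 * t)] exceeds [M1 + M2 * t] by [s1 * s2 * (1 + t)]. *)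
have le_c : c * t + m / c <= 2 * (h1 + h2 * t).
  have le_mc : m / c <= s1 + s2 * t.
    rewrite ler_pdivrMr//; apply: le_trans le_g _.
    have -> : M1 = s1 ^+ 2 by rewrite sqr_sqrtr// ltW.
    have -> : M2 = s2 ^+ 2 by rewrite sqr_sqrtr// ltW.
    rewrite /c -subr_ge0.
    rewrite (_ : _ - _ = s1 * s2 * (1 + t)); last by ring.
    by rewrite mulr_ge0 ?addr_ge0 ?mulr_ge0// ltW.
  rewrite /h2 /h1 -/s1 -/s2 /c; move: le_mc; rewrite /c; lra.
have le_Y : (hi - lo) * (2^-1 * (c * t + m / c)) <= (hi - lo) * (h1 + h2 * t).
  by rewrite ler_wpM2l ?subr_ge0//; move: le_c; lra.
have -> : a * t + b * m = (hi - lo) * (2^-1 * (c * t + m / c))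
    + L / 2 * (hi ^+ 2 * m) by rewrite /a /b; ring.
by move: le_q le_m le_Y; lra.
Qed.

End expected_descent.

(** * The iterates as explicit random gradient steps *)

Section iterates.
Context d (T : measurableType d) (R : realType) (n : nat).
Context (alpha gamma1 gamma2 mu_min mu0 : R) (x0 : 'rV[R]_n)
  (x g p : nat -> T -> 'rV[R]_n) (mu : nat -> T -> R).
Hypothesis algorithm : TRishBB alpha gamma1 gamma2 mu_min mu0 x0 x g p mu.

Lemma TRishBB_stepE k w : p k w =
  - tr_step (tr_radius alpha gamma1 gamma2 (enorm (g k w))) (mu k w) (g k w)
    *: g k w.
Proof.
case: algorithm => a0 g20 g12 mm0 _ _ _ _ _ muge pE _.
apply: tr_solutionE (pE k w); first exact: lt_le_trans (muge k w).
by move=> ->; rewrite enorm0 tr_radius0.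
Qed.

(** Measurability of [p] is not postulated; it comes from the explicit form of the step in terms of
    [g] and [mu], by induction on [k]. *)
Lemma TRishBB_random k : random_vector (x k).
Proof.
case: algorithm => _ _ _ _ _ mg mmu xi _ _ _ xn.
elim: k => [|k IH] i.
  by rewrite (_ : (fun w => _) = cst (x0 0 i))//; apply/funext => w; rewrite xi.
pose s w :=
  tr_step (tr_radius alpha gamma1 gamma2 (enorm (g k w))) (mu k w) (g k w).
rewrite (_ : (fun w => _) =
    (fun w => x k w 0 i) \- (s \* (fun w => g k w 0 i))).
  apply: measurable_funB; first exact: IH.
  by apply: measurable_funM; [exact: measurable_tr_step|exact: mg].
by apply/funext => w; rewrite xn TRishBB_stepE !mxE /= mulNr.
Qed.

Lemma TRishBB_step k w : mu_min <= gamma2 * alpha ->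
  exists2 s, mu_min <= s <= alpha * gamma1 & x k.+1 w = x k w - s *: g k w.
Proof.
case: (algorithm) => a0 g20 g12 mm0 _ _ _ _ _ muge pE xn mm_le.
rewrite xn TRishBB_stepE; have [->|g0] := eqVneq (g k w) 0.
  (* When the stochastic gradient vanishes every length gives the same point; [mu_min] meets both
     bounds. *)
  exists mu_min; last by rewrite !scaler0 addr0 subr0.
  by rewrite lexx (le_trans mm_le)// mulrC ler_pM2l.
exists (tr_step (tr_radius alpha gamma1 gamma2 (enorm (g k w))) (mu k w)
  (g k w)); last by rewrite scaleNr.
exact: tr_step_bounds.
Qed.

End iterates.

(* For [k = 0] the hypothesis reads [u 0 <= l], as [0^-1 = 0]. *)
Lemma limn_esup_le_inv (R : realType) (u : nat -> \bar R) (l C : R) :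
  (forall k, (u k <= (l + k%:R^-1 * C)%:E)%E) -> (limn_esup u <= l%:E)%E.
Proof.
move=> ub.
have cv : (l + k%:R^-1 * C)%:E @[k --> \oo] --> l%:E.
  apply: cvg_EFin; first exact: nearW.
  rewrite -[X in _ --> X]addr0 -(mul0r C); apply: cvgD; first exact: cvg_cst.
  apply: cvgMl.
  (* The harmonic sequence consists of the inverses of [k.+1], hence the shift. *)
  by rewrite -(cvg_shiftS (fun k => k%:R^-1 : R)); exact: cvg_harmonic.
rewrite -(cvg_limn_einf_sup cv).2 !limn_esup_lim.
apply: lee_lim; [exact: is_cvg_esups|exact: is_cvg_esups|].
apply: nearW => k; apply: ge_ereal_sup => _ [j kj <-].
by apply: le_trans (ub j) _; apply: ereal_sup_ubound; exists j.
Qed.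

Theorem theorem3p2 (R : realType) (d : measure_display) (T : measurableType d)
  (P : probability T R)
  (n N : nat) (N_gt0 : (0 < N)%N)
  (f_ : 'I_N -> 'rV[R]_n -> R) (f_C1 : forall i, cont_diff (f_ i))
  (f : 'rV[R]_n -> R) (fE : forall y, f y = average f_ y)
  (alpha gamma1 gamma2 mu_min mu0 : R) (x0 : 'rV[R]_n)
  (x g p : nat -> T -> 'rV[R]_n) (mu : nat -> T -> R)
  (algorithm : TRishBB alpha gamma1 gamma2 mu_min mu0 x0 x g p mu)
  (fC1 : cont_diff f)
  (fstar : R) (f_lower : forall y, fstar <= f y)
  (L : R) (L_gt0 : 0 < L)
  (f_smooth : forall y z : 'rV[R]_n,
     f y <= f z + dotp (grad f z) (y - z) + L / 2 * enorm (y - z) ^+ 2)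
  (Eg : nat -> T -> 'rV[R]_n) (Eg2 : nat -> T -> R)
  (EgE : forall k, is_condexp_vector P (sigma_vector (x k)) (g k) (Eg k))
  (Eg2E : forall k,
     is_condexp P (sigma_vector (x k)) (fun w => enorm (g k w) ^+ 2) (Eg2 k))
  (omega M1 M2 : R) (omega_gt0 : 0 < omega) (M1_gt0 : 0 < M1) (M2_gt0 : 0 < M2)
  (g_mean : forall k, {ae P, forall w,
     omega * enorm (grad f (x k w)) ^+ 2 <= dotp (grad f (x k w)) (Eg k w)})
  (g_second_moment : forall k, {ae P, forall w,
     Eg2 k w <= M1 + M2 * enorm (grad f (x k w)) ^+ 2})
  (mu_min_le : 0 < mu_min <= gamma2 * alpha) :
  let h1 : R := 2^-1 * Num.sqrt M1 in
  let h2 : R := h1 + Num.sqrt M2 in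
  let rho : R := mu_min / (alpha * gamma2) in
  let theta1 : R := 2^-1 * omega * gamma1 - h2 * (gamma1 - rho * gamma2) in
  let theta2 : R := h1 * (gamma1 * alpha - mu_min)
                + 2^-1 * gamma1 ^+ 2 * L * M1 * alpha ^+ 2 in
  (0 < h2 - 2^-1 * omega ->
     gamma1 / gamma2 < rho * h2 / (h2 - 2^-1 * omega)) ->
  alpha <= omega / (gamma1 * L * M2) ->
  (limn_esup (fun K : nat =>
     \sum_(0 <= k < K.+1)
        'E_P[(fun w : T => K%:R^-1 * enorm (grad f (x k w)) ^+ 2)%R])
   <= (theta2 / (alpha * theta1))%R%:E)%E.
Proof.
move=> h1 h2 rho theta1 theta2 gamma_ratio alpha_le.
have [a0 g20 g12 mm0 _ mg mmu xi _ _ _ _] := algorithm.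
have mm_le : mu_min <= gamma2 * alpha by case/andP: mu_min_le.
have g10 : 0 < gamma1 by exact: lt_le_trans g12.
pose hi := alpha * gamma1.
have hi0 : 0 < hi by exact: mulr_gt0.
have lo_hi : mu_min <= hi by rewrite (le_trans mm_le)// mulrC ler_pM2l.
have mx := TRishBB_random algorithm.
pose Int (u : T -> R) := P.-integrable setT (EFin \o u).
pose t k := \int[P]_w (enorm (grad f (x k w)) ^+ 2).
pose F k := \int[P]_w f (x k w).
have descent k := expected_descent fC1 f_lower L_gt0 f_smooth (mx k) (mg k)
  (mx k.+1) (EgE k) (Eg2E k) M1_gt0 M2_gt0 (g_mean k) (g_second_moment k)
  mm0 lo_hi (fun w => TRishBB_step algorithm k w mm_le).
have if_ k : Int (fun w => f (x k w)).
  elim: k => [|k IH]; last by have [] := descent k IH.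
  rewrite (_ : (fun w => _) = cst (f x0)).
    exact: finite_measure_integrable_cst.
  by apply/funext => w; rewrite xi.
have it k : Int (fun w => enorm (grad f (x k w)) ^+ 2).
  exact: (integrable_sqr_grad fC1 f_lower L_gt0 f_smooth (mx k) (if_ k)).
have t0 k : 0 <= t k by apply: Rintegral_ge0 => w _; exact: sqr_ge0.
have F_ge k : fstar <= F k.
  have -> : fstar = \int[P]_w cst fstar w.
    by rewrite Rintegral_cst//= probability_setT mulr1.
  apply: le_Rintegral (if_ k) (fun w _ => f_lower _) => //.
  exact: finite_measure_integrable_cst.
have s1_gt0 : 0 < Num.sqrt M1 by rewrite sqrtr_gt0.
have s2_gt0 : 0 < Num.sqrt M2 by rewrite sqrtr_gt0.
have h1_gt0 : 0 < h1 by rewrite mulr_gt0// invr_gt0.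
have h2_gt0 : 0 < h2 by rewrite addr_gt0.
have rho_gt0 : 0 < rho by rewrite divr_gt0// mulr_gt0.
(* In the rearranged form, [gamma_ratio] with denominators cleared is exactly positivity when
   [h2 - 2^-1 * omega] is positive; otherwise a nonpositive term is subtracted from a positive
   one. *)
have theta1_gt0 : 0 < theta1.
  have -> : theta1 = rho * h2 * gamma2 - gamma1 * (h2 - 2^-1 * omega).
    by rewrite /theta1; ring.
  have [h|h] := ltP 0 (h2 - 2^-1 * omega).
    have := gamma_ratio h; rewrite ltr_pdivrMr// mulrAC ltr_pdivlMr//; lra.
  rewrite subr_gt0; apply: (@le_lt_trans _ _ 0).
    by rewrite pmulr_rle0.
  by rewrite mulr_gt0// mulr_gt0.
have ath_gt0 : 0 < alpha * theta1 by exact: mulr_gt0.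
have theta1E : alpha * theta1 = 2^-1 * hi * omega - h2 * (hi - mu_min).
  by rewrite /theta1 /rho /hi; field; rewrite !gt_eqF.
have theta2_ge0 : 0 <= theta2.
  apply: addr_ge0; first by rewrite mulr_ge0 ?(ltW h1_gt0)// subr_ge0 mulrC.
  have L2 : 0 < 2^-1 * gamma1 ^+ 2 * L * M1.
    by rewrite !mulr_gt0// invr_gt0.
  by rewrite mulr_ge0 ?sqr_ge0// ltW.
have recur k : F k.+1 <= F k - alpha * theta1 * t k + theta2.
  have [_ /le_trans] := descent k (if_ k); apply.
  (* The bound on [alpha] makes the quadratic term [L / 2 * hi ^+ 2 * M2 * t k] cost at most half of
     the decrease [hi * omega * t k]; the other half remains in [theta1]. *)
  have hiL : hi * L * M2 <= omega.
    move: alpha_le; rewrite ler_pdivlMr ?mulr_gt0// /hi; lra.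
  have := ler_wpM2l (t0 k) (ler_wpM2l (ltW hi0) hiL).
  rewrite theta1E /theta2 -/(t k) -/(F k) -/h1 -/h2 -/hi.
  have -> : gamma1 * alpha = hi by rewrite mulrC.
  have -> : 2^-1 * gamma1 ^+ 2 * L * M1 * alpha ^+ 2 = 2^-1 * hi ^+ 2 * L * M1.
    by rewrite /hi; ring.
  lra.
have sum_le m : alpha * theta1 * \sum_(0 <= k < m) t k <=
    F 0%N - F m + m%:R * theta2.
  elim: m => [|m IH]; first by rewrite big_geq// mulr0 subrr mul0r addr0.
  rewrite big_nat_recr//= mulrDr -natr1; have := recur m; move: IH; lra.
pose l := theta2 / (alpha * theta1).
(* The extra [l] accounts for [K.+1] summands being divided by [K]. *)
pose C := (F 0%N - fstar) / (alpha * theta1) + l.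
have l0 : 0 <= l by rewrite divr_ge0// ltW.
apply: (@limn_esup_le_inv _ _ _ C) => K.
(* Integrability makes the extended-real expectations finite, so the average becomes a real
   number. *)
have -> : (\sum_(0 <= k < K.+1)
    'E_P[(fun w : T => K%:R^-1 * enorm (grad f (x k w)) ^+ 2)%R])%E
    = (K%:R^-1 * \sum_(0 <= k < K.+1) t k)%:E.
  rewrite mulr_sumr -sumEFin; apply: eq_bigr => k _.
  have -> : K%:R^-1 * t k =
      \int[P]_w (K%:R^-1 * enorm (grad f (x k w)) ^+ 2).
    by rewrite RintegralZl//; exact: it.
  rewrite unlock /Rintegral fineK//; apply: integrable_fin_num => //.
  exact: integrable_scale (it k).
rewrite lee_fin -/l.
(* For [K = 0] the convention [0^-1 = 0] reduces the claim to [0 <= l]. *)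
case: K => [|K]; first by rewrite invr0 !mul0r addr0.
have := sum_le K.+2; have := F_ge K.+2.
set S := \sum_(_ <= _ < _) _ => FK SK.
have {}SK : S <= C + K.+1%:R * l.
  rewrite -(ler_pM2l ath_gt0); apply: le_trans SK _.
  have -> : alpha * theta1 * (C + K.+1%:R * l) =
      F 0%N - fstar + (K.+1%:R + 1) * theta2.
    by rewrite /C /l; field; rewrite !gt_eqF.
  by rewrite natr1 lerD2r lerB.
have K0 : 0 < K.+1%:R^-1 :> R by rewrite invr_gt0.
apply: le_trans (ler_wpM2l (ltW K0) SK) _.
by rewrite mulrDr mulKf ?pnatr_eq0// addrC.
Qed.
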